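(* Let $p\in(0,\infty)$. Then $$r(p)=U_\infty(p)=L_\infty(p),$$ and the series $\sum_{m=1}^\infty 2^{-1-m}\sigma_{p,m}$ (which defines $\ln U_\infty(p)$) converges uniformly in $p\in[p_0,\infty)$, for any $p_0\in(0,\infty)$. Moreover, for all $k\in\{0,1,\dots\}$ the inequalities $$L_k(p)<L_{k+1}(p)<r(p)<U_{k+1}(p)<U_k(p)$$ hold. For the relative errors $$\delta_{\mathsf{up},k}(p):=\frac{U_k(p)-r(p)}{r(p)}=\Big|\frac{U_k(p)-r(p)}{r(p)}\Big|\quad\text{and}\quad \delta_{\mathsf{lo},k}(p):=\frac{r(p)-L_k(p)}{r(p)}=\Big|\frac{L_k(p)-r(p)}{r(p)}\Big|$$ one has, for all $k\in\{0,1,\dots\}$, $$0<\delta_{\mathsf{lo},k}(p)<\delta_{\mathsf{up},k}(p)<\exp(\rho^*_{p,k})-1,$$ where $$\rho^*_{p,k}:=\frac1{2^{k+1}}\,\min\Big(\frac{(k+1)!}{p^{k+1}},\ \ln\frac{p+1}p\Big),$$ which converges to $0$ as $k\to\infty$ (no slower than geometrically) uniformly in $p\in[p_0,\infty)$, for any $p_0\in(0,\infty)$, and also converges, for each $k\in\{0,1,\dots\}$, to $0$ as $p\to\infty$.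
   Context: For $p\in(0,\infty)$, $$r(p):=\sqrt{\frac2p}\,\frac{\Gamma\big(\frac{p+1}2\big)}{\Gamma\big(\frac p2\big)}$$ (this is $f_p(0)/f_\infty(0)$, where $f_p$ is the density of Student's distribution with $p$ degrees of freedom and $f_\infty$ is the standard normal density). For $p\in(0,\infty)$, integers $m\ge 0$, and $k\in\{0,1,\dots,\infty\}$, $$\sigma_{p,m}:=\sum_{j=0}^m(-1)^j\binom mj\ln(p+j),\qquad U_k(p):=\exp\sum_{m=1}^k2^{-1-m}\sigma_{p,m},\qquad L_k(p):=\sqrt{\frac p{p+1}}\,\frac1{U_k(p+1)}.$$ The sum of an empty family is $0$, so $U_0(p)=1$. In the definition of $\rho^*_{p,k}$, $p^{k+1}$ is the ordinary power. Convergence of $\rho^*_{p,k}$ to $0$ ''no slower than geometrically, uniformly in $p\in[p_0,\infty)$'' means that there are constants $C\in(0,\infty)$ and $q\in(0,1)$ (possibly depending on $p_0$) with $0\le\rho^*_{p,k}\le Cq^k$ for all $p\ge p_0$ and all $k\in\{0,1,\dots\}$. *)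

(* Defs.v *)
From HB Require Import structures.
From mathcomp Require Import all_boot all_order all_algebra.
From mathcomp Require Import all_classical all_reals all_analysis.

Set Implicit Arguments.
Unset Strict Implicit.
Unset Printing Implicit Defensive.

Import Order.TTheory GRing.Theory Num.Theory.
Import numFieldNormedType.Exports.

Local Open Scope classical_set_scope.
Local Open Scope ring_scope.

(* Euler's integral; it is the Gamma function only for [0 < x], where the
   integrand is integrable. *)
Definition Gamma {R : realType} (x : R) : R :=
  \int[lebesgue_measure]_(t in `]0, +oo[) (t `^ (x - 1) * expR (- t)).

Definition r {R : realType} (p : R) : R :=
  Num.sqrt (2 / p) * (Gamma ((p + 1) / 2) / Gamma (p / 2)).

Definition sigma {R : realType} (p : R) (m : nat) : R :=
  \sum_(0 <= j < m.+1) (-1) ^+ j * 'C(m, j)%:R * ln (p + j%:R).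

Definition lnU {R : realType} (k : nat) (p : R) : R :=
  \sum_(1 <= m < k.+1) 2 ^- m.+1 * sigma p m.

(* Meaningful only where the series converges: [limn] is total. *)
Definition lnU_oo {R : realType} (p : R) : R := limn (fun k => lnU k p).

Definition U {R : realType} (k : nat) (p : R) : R := expR (lnU k p).

Definition U_oo {R : realType} (p : R) : R := expR (lnU_oo p).

Definition L {R : realType} (k : nat) (p : R) : R :=
  Num.sqrt (p / (p + 1)) * (U k (p + 1))^-1.

Definition L_oo {R : realType} (p : R) : R :=
  Num.sqrt (p / (p + 1)) * (U_oo (p + 1))^-1.

Definition delta_up {R : realType} (k : nat) (p : R) : R := (U k p - r p) / r p.

Definition delta_lo {R : realType} (k : nat) (p : R) : R := (r p - L k p) / r p.

Definition rho {R : realType} (k : nat) (p : R) : R :=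
  2 ^- k.+1 * Num.min (k.+1`!%:R / p ^+ k.+1) (ln ((p + 1) / p)).

(* Main.v *)
Require Import Defs.
From HB Require Import structures.
From mathcomp Require Import all_boot all_order all_algebra.
From mathcomp Require Import all_classical all_reals all_analysis.
From mathcomp Require Import measurable_realfun ring lra.

Import Order.TTheory GRing.Theory Num.Theory.
Import numFieldNormedType.Exports.

Local Open Scope classical_set_scope.
Local Open Scope ring_scope.

(** Everything follows from one functional equation. Write [g p = ln (r p)].
    The recurrence [Gamma (x + 1) = x * Gamma x] makes the Gamma factors of
    [r p * r (p + 1)] cancel ([r_shift]), so that
    [g p + g (p + 1) = sigma p 1 / 2].
    The differences satisfy [sigma p (m + 1) = sigma p m - sigma (p + 1) m], so
    the sum [lnU k p + lnU k (p + 1)] telescopes ([lnU_shift]) to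
    [sigma p 1 / 2 - 2 ^- (k + 1) * sigma p (k + 1)].
    Hence the gap [d p = lnU k p - g p] satisfies
      [d p + d (p + 1) = s p]  with  [s p = - 2 ^- (k + 1) * sigma p (k + 1)].

    By the mean value theorem, [- sigma p (m + 1)] is a value at some [x > p] of
    the [p]-derivative of [sigma p m], which is the explicit positive function
    [m! / (x (x + 1) ... (x + m))] ([sigmaS_mean]). This gives the sign of
    [sigma], the bound [s p <= rho k p], and, as [s p - s (p + 1)] is again a
    positive multiple of some [- sigma p m], the strict decrease of [s].

    Both [g] and [lnU k] are nonpositive and vanish at infinity; for [g] the
    upper bound is [r p <= 1], that is, [Gamma (x + 1/2) <= sqrt x * Gamma x],
    which is the inequality of the arithmetic and geometric means under the
    integral. So [d p] is the sum of the alternating series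
    [s p - s (p + 1) + s (p + 2) - ...], which is positive and smaller than its
    first term, [0 < d p < s p]; the same argument applied to [d p - d (p + 1)]
    gives [d (p + 1) < d p]. Since [U k p = r p * exp (d p)] and
    [L k p = r p * exp (- d (p + 1))], all the inequalities and error bounds
    follow, and [rho k p <= 2 ^- (k + 1) / p] gives the limits. *)

(** * The Gamma function *)

Definition gamma_kernel {R : realType} (x t : R) : R :=
  t `^ (x - 1) * expR (- t).

Lemma gamma_kernel_ge0 {R : realType} (x t : R) : 0 <= gamma_kernel x t.
Proof. by rewrite mulr_ge0 ?powR_ge0 ?expR_ge0. Qed.

Lemma measurable_gamma_kernel {R : realType} (D : set R) (x : R) :
  measurable_fun D (gamma_kernel x : R -> R).
Proof.
apply: measurable_funTS.
apply: measurable_funM; first exact: measurable_powR.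
by apply: measurableT_comp.
Qed.

Lemma continuous_powR {R : realType} (x t : R) : 0 < t ->
  {for t, continuous (@powR R ^~ x)}.
Proof.
move=> t0; apply/differentiable_continuous; rewrite -derivable1_diffP.
exact: (@ex_derive _ _ _ _ _ _ _ (is_derive1_powR x t0)).
Qed.

Lemma continuous_expRN {R : realType} : continuous (fun t : R => expR (- t)).
Proof.
move=> t; apply: (@continuous_comp _ _ _ -%R expR).
  exact: oppr_continuous.
exact: continuous_expR.
Qed.

(** Integration by parts on a segment away from [0], where the integrand is
    continuous even if [x < 1]. *)
Lemma gamma_integral_segment {R : realType} (x a b : R) :
  0 < x -> 0 < a -> a < b ->
  (\int[lebesgue_measure]_(t in `[a, b]) (gamma_kernel (x + 1) t)%:E =
   (a `^ x * expR (- a) - b `^ x * expR (- b))%:E +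
   x%:E * \int[lebesgue_measure]_(t in `[a, b]) (gamma_kernel x t)%:E)%E.
Proof.
move=> x0 a0 ab.
have in_gt0 t : a <= t -> 0 < t by exact: lt_le_trans.
have expN' (t : R) : is_derive t 1 (fun t => - expR (- t)) (expR (- t)).
  by apply: is_derive_eq; rewrite mulrN1 opprK.
have : (\int[lebesgue_measure]_(t in `[a, b]) (t `^ x * expR (- t))%:E =
    (b `^ x * - expR (- b) - a `^ x * - expR (- a))%:E -
    \int[lebesgue_measure]_(t in `[a, b])
      (x * t `^ (x - 1) * - expR (- t))%:E)%E.
  apply: (@integration_by_parts R (@powR R ^~ x) (fun t => - expR (- t))
    (fun t => x * t `^ (x - 1)) (fun t => expR (- t)) a b ab).
  - apply: continuous_in_subspaceT => t.
    rewrite inE/= in_itv/= => /andP[/in_gt0 t0 _].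
    by apply: cvgMl_tmp; exact: continuous_powR.
  - split.
    + move=> t; rewrite in_itv/= => /andP[/ltW/in_gt0 t0 _].
      exact: (@ex_derive _ _ _ _ _ _ _ (is_derive1_powR x t0)).
    + by apply: cvg_at_right_filter; exact: continuous_powR.
    + by apply: cvg_at_left_filter; apply: continuous_powR; lra.
  - move=> t; rewrite in_itv/= => /andP[/ltW/in_gt0 t0 _].
    by rewrite derive1E (@derive_val _ _ _ _ _ _ _ (is_derive1_powR x t0)).
  - by apply: continuous_subspaceT; exact: continuous_expRN.
  - split.
    + by move=> t _; exact: ex_derive.
    + by apply: cvg_at_right_filter; apply: cvgN; exact: continuous_expRN.
    + by apply: cvg_at_left_filter; apply: cvgN; exact: continuous_expRN.
  - by move=> t _; rewrite derive1E derive_val.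
rewrite /gamma_kernel addrK => ->.
under [X in (_ - X)%E]eq_integral => t _ do
  rewrite mulrN -mulrA EFinN EFinM.
rewrite integral_ge0N; last first.
  by move=> t _; rewrite -EFinM lee_fin mulr_ge0 ?(ltW x0)//;
    exact: gamma_kernel_ge0.
rewrite ge0_integralZl_EFin//; last 3 first.
- by move=> t _; rewrite lee_fin; exact: gamma_kernel_ge0.
- apply/measurable_EFinP.
  exact: measurable_gamma_kernel.
- exact: ltW.
by rewrite oppeK !mulrN opprK [- _ + _]addrC.
Qed.

(** The exponential series gives [expR y >= y ^+ N.+1 / N.+1`!], so the
    product is at most [N.+1`! / y] for any integer [N >= x]. *)
Lemma powR_expRN_cvg0 {R : realType} (x : R) :
  (n.+2%:R `^ x * expR (- n.+2%:R)) @[n --> \oo] --> (0 : R).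
Proof.
have [N xN] : exists N : nat, x <= N%:R.
  by exists (Num.truncn x).+1; apply/ltW/truncnS_gt.
apply: (@squeeze_cvgr _ _ _ _ (cst 0) (fun n => N.+1`!%:R * n.+1%:R^-1)).
- near=> n.
  rewrite mulr_ge0 ?powR_ge0 ?expR_ge0//= expRN.
  apply: (@le_trans _ _ (n.+2%:R ^+ N / (n.+2%:R ^+ N.+1 / N.+1`!%:R))).
    apply: ler_pM => //.
    - by rewrite -powR_mulrn// ler_powR// ler1n.
    - rewrite lef_pV2 ?posrE ?expR_gt0 ?divr_gt0 ?exprn_gt0 ?ltr0n ?fact_gt0//.
      by have := @expR_ge1Dxn R n.+2%:R N (ler0n _ _); lra.
  rewrite [leLHS](_ : _ = N.+1`!%:R / n.+2%:R); last first.
    have : 0 < n.+2%:R :> R by []; move: (n.+2%:R : R) => y y0.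
    rewrite exprS; field.
    by rewrite expf_neq0 ?gt_eqF ?ltr0n ?fact_gt0.
  by rewrite ler_wpM2l// lef_pV2 ?posrE// ler_nat.
- exact: cvg_cst.
- rewrite -[X in _ --> X](mulr0 (N.+1`!%:R)); apply: cvgMl_tmp.
  exact: cvg_harmonic.
Unshelve. all: end_near. Qed.

Lemma powR_expRN_inv_cvg0 {R : realType} (x : R) : 0 < x ->
  (n.+2%:R^-1 `^ x * expR (- n.+2%:R^-1)) @[n --> \oo] --> (0 : R).
Proof.
move=> x0; rewrite -[X in _ --> X](mul0r (expR (- 0))).
have cvV : (n.+2%:R^-1 : R) @[n --> \oo] --> (0 : R).
  by have := @cvg_harmonic R; rewrite -cvg_shiftS.
apply: cvgM.
  have /cvg_at_rightP := powR_cvg0 x0.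
  by apply; split.
apply: (cvg_comp (fun n => n.+2%:R^-1) (fun t : R => expR (- t)) cvV).
exact: continuous_expRN.
Qed.

(** Monotone convergence in the extended reals: integrability on the half-line
    is not yet known, and is deduced from the recurrence this limit yields. *)
Lemma cvg_gamma_integral_segment {R : realType} (x : R) :
  (\int[lebesgue_measure]_(t in `[n.+2%:R^-1%R, n.+2%:R%R])
    (gamma_kernel x t)%:E)%E
    @[n --> \oo] -->
  (\int[lebesgue_measure]_(t in `]0%R, +oo[) (gamma_kernel x t)%:E)%E.
Proof.
rewrite (_ : [set` `]0, +oo[] =
    \bigcup_n [set` `[n.+2%:R^-1, n.+2%:R]] :> set R).
  apply: ge0_nondecreasing_set_cvg_integral.
  - move=> m n mn; rewrite subsetEset; apply: subset_itv.
      by rewrite bnd_simp lef_pV2 ?posrE// ler_nat !ltnS.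
    by rewrite bnd_simp ler_nat !ltnS.
  - by move=> n.
  - by move=> n; apply/measurable_EFinP; exact: measurable_gamma_kernel.
  - by move=> n t _; rewrite lee_fin gamma_kernel_ge0.
apply/seteqP; split => t /=.
  rewrite in_itv/= andbT => t0.
  (* the segment of index [n] contains [t] once [n >= t] and [n >= t^-1] *)
  exists (Num.truncn (t + t^-1)) => //=.
  have := truncnS_gt (t + t^-1).
  set n := Num.truncn _ => tn.
  have tV0 : 0 < t^-1 by rewrite invr_gt0.
  rewrite in_itv/= invf_ple ?posrE//.
  by move: tn; rewrite -[n.+2%:R]natr1; move: (n.+1%:R : R) => y; lra.
move=> [n _]; rewrite /= !in_itv/= andbT => /andP[+ _].
by apply: lt_le_trans; rewrite invr_gt0.
Qed.

Lemma gamma_integralS {R : realType} (x : R) : 0 < x ->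
  (\int[lebesgue_measure]_(t in `]0%R, +oo[) (gamma_kernel (x + 1) t)%:E =
   x%:E * \int[lebesgue_measure]_(t in `]0%R, +oo[) (gamma_kernel x t)%:E)%E.
Proof.
move=> x0; apply: cvg_unique (cvg_gamma_integral_segment (x + 1)) _ => //=.
under eq_cvg => n.
  rewrite gamma_integral_segment// ?invr_gt0//; last first.
    by rewrite (@lt_trans _ _ 1) ?invf_lt1// ltr1n.
  over.
rewrite -(add0e (x%:E * _)%E); apply: cvgeD => //.
- apply: cvg_EFin; first exact: nearW.
  rewrite -(subr0 0); apply: cvgB.
    exact: powR_expRN_inv_cvg0.
  exact: powR_expRN_cvg0.
- by apply: cvgeZl => //; exact: cvg_gamma_integral_segment.
Qed.

Lemma gamma_integral_nat_lty {R : realType} (n : nat) :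
  (\int[lebesgue_measure]_(t in `]0%R, +oo[)
    (gamma_kernel (n.+1%:R : R) t)%:E < +oo)%E.
Proof.
elim: n => [|n IH]; last first.
  by rewrite -natr1 gamma_integralS// lte_mul_pinfty//.
under eq_integral => t _ do rewrite /gamma_kernel subrr powRr0 mul1r.
rewrite integral_itv_obnd_cbnd; last first.
  by apply/measurable_EFinP; apply: measurableT_comp.
have expN' (t : R) : is_derive t 1 (fun t => - expR (- t)) (expR (- t)).
  by apply: is_derive_eq; rewrite mulrN1 opprK.
rewrite (@ge0_continuous_FTC2y R _ (fun t => - expR (- t)) 0 0) ?ltry//.
- by apply: continuous_subspaceT; exact: continuous_expRN.
- by rewrite -(oppr0 R); apply: cvgN; exact: cvgr_expR.
- by apply: cvg_at_right_filter; apply: cvgN; exact: continuous_expRN.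
- by move=> t _; rewrite derive1E derive_val.
Qed.

(** The recurrence reduces [x] to [x + 1 >= 1], where the integrand has no
    singularity at [0] and is dominated by two integrands of integer
    parameters, one for each side of [t = 1]. *)
Lemma gamma_integral_lty {R : realType} (x : R) : 0 < x ->
  (\int[lebesgue_measure]_(t in `]0%R, +oo[) (gamma_kernel x t)%:E < +oo)%E.
Proof.
move=> x0.
have [N xN] : exists N : nat, x <= N%:R.
  by exists (Num.truncn x).+1; apply/ltW/truncnS_gt.
suff: (\int[lebesgue_measure]_(t in `]0%R, +oo[)
    (gamma_kernel (x + 1) t)%:E < +oo)%E.
  rewrite gamma_integralS// !ltey; apply: contraNN => /eqP ->.
  by rewrite gt0_muley ?lte_fin.
apply: le_lt_trans (_ : (\int[lebesgue_measure]_(t in `]0%R, +oo[)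
  ((gamma_kernel 1%:R t)%:E + (gamma_kernel N.+1%:R t)%:E) < +oo)%E); last first.
  rewrite ge0_integralD//=.
  - by rewrite lte_add_pinfty// gamma_integral_nat_lty.
  - by move=> t _; rewrite lee_fin gamma_kernel_ge0.
  - by apply/measurable_EFinP; exact: measurable_gamma_kernel.
  - by move=> t _; rewrite lee_fin gamma_kernel_ge0.
  - by apply/measurable_EFinP; exact: measurable_gamma_kernel.
apply: ge0_le_integral => //=.
- by move=> t _; rewrite lee_fin gamma_kernel_ge0.
- by apply/measurable_EFinP; exact: measurable_gamma_kernel.
- apply/measurable_EFinP; apply: measurable_funD;
  exact: measurable_gamma_kernel.
move=> t; rewrite in_itv/= andbT => t0.
rewrite -EFinD lee_fin; have [t1|/ltW t1] := leP t 1.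
  apply: ler_wpDr; first exact: gamma_kernel_ge0.
  rewrite ler_wpM2r ?expR_ge0// ger_powR ?t0//; lra.
apply: ler_wpDl; first exact: gamma_kernel_ge0.
rewrite ler_wpM2r ?expR_ge0// ler_powR// -natr1; lra.
Qed.

Lemma integrable_gamma_kernel {R : realType} (x : R) : 0 < x ->
  lebesgue_measure.-integrable `]0, +oo[ (EFin \o gamma_kernel x).
Proof.
move=> x0; apply/integrableP; split.
  by apply/measurable_EFinP; exact: measurable_gamma_kernel.
under eq_integral => t _ do rewrite /= ger0_norm ?gamma_kernel_ge0//.
exact: gamma_integral_lty.
Qed.

Lemma GammaS {R : realType} (x : R) : 0 < x -> Gamma (x + 1) = x * Gamma x.
Proof.
move=> x0; rewrite /Gamma /Rintegral (gamma_integralS x x0) fineM//.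
exact: (integrable_fin_num _ (integrable_gamma_kernel x x0)).
Qed.

(** After a shift of [x] by one, the integrand is at least [expR (- 2)] on
    [[1, 2]]. *)
Lemma Gamma_gt0 {R : realType} (x : R) : 0 < x -> 0 < Gamma x.
Proof.
move=> x0; suff: 0 < Gamma (x + 1) by rewrite GammaS// pmulr_rgt0.
have x10 : 0 < x + 1 by rewrite addr_gt0.
apply: fine_gt0; rewrite (gamma_integral_lty (x + 1) x10) andbT.
have mk (D : set R) :
    measurable_fun D (EFin \o gamma_kernel (x + 1) : R -> \bar R).
  by apply/measurable_EFinP; exact: measurable_gamma_kernel.
apply: (@lt_le_trans _ _
  (\int[lebesgue_measure]_(t in `[1%R, 2%R]) (cst (expR (- 2))%:E t))%E).
  rewrite integral_cst//= lebesgue_measure_itv/= lte_fin ltr1n -EFinD -EFinM.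
  by rewrite lte_fin mulr_gt0 ?expR_gt0//; lra.
apply: (@le_trans _ _
  (\int[lebesgue_measure]_(t in `[1%R, 2%R]) (gamma_kernel (x + 1) t)%:E)%E).
  apply: ge0_le_integral => //=.
  - exact: mk.
  - move=> t; rewrite in_itv/= => /andP[t1 t2]; rewrite lee_fin.
    rewrite -[leLHS]mul1r /gamma_kernel addrK ler_pM ?expR_ge0 ?ler_expR//.
      by rewrite -(powRr0 t) ler_powR// ltW.
    lra.
apply: ge0_subset_integral => //=.
- exact: mk.
- by move=> t _; rewrite lee_fin gamma_kernel_ge0.
- move=> t /=; rewrite !in_itv/= andbT => /andP[+ _]; lra.
Qed.

(** With [s = sqrt x] and [u = sqrt t], integrating
    [2 s u <= s ^+ 2 + u ^+ 2] against [t `^ (x - 1) * expR (- t)] gives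
    [2 s Gamma (x + 1/2) <= x Gamma x + Gamma (x + 1) = 2 s ^+ 2 Gamma x]. *)
Lemma Gamma_half_le {R : realType} (x : R) : 0 < x ->
  Gamma (x + 2^-1) <= Num.sqrt x * Gamma x.
Proof.
move=> x0.
have s0 : 0 < Num.sqrt x by rewrite sqrtr_gt0.
have xE : x = Num.sqrt x ^+ 2 by rewrite sqr_sqrtr// ltW.
move: (Num.sqrt x) s0 xE => s s0 xE.
have ix := integrable_gamma_kernel x x0.
have ix1 : lebesgue_measure.-integrable `]0, +oo[
    (EFin \o gamma_kernel (x + 1)).
  by apply: integrable_gamma_kernel; rewrite addr_gt0.
have ix2 : lebesgue_measure.-integrable `]0, +oo[
    (EFin \o gamma_kernel (x + 2^-1)).
  by apply: integrable_gamma_kernel; rewrite addr_gt0// invr_gt0.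
have main : 2 * s * Gamma (x + 2^-1) <= x * Gamma x + Gamma (x + 1).
  rewrite /Gamma -!RintegralZl// -RintegralD//; last exact: integrableZl ix.
  apply: le_Rintegral => //.
  - exact: (integrableZl _ _ ix2).
  - by apply: (integrableD _ (integrableZl _ x ix) ix1).
  move=> t /=; rewrite in_itv/= andbT => t0.
  have tn0 : t != 0 by rewrite gt_eqF.
  have t_shift y : t `^ (x - 1 + y) = t `^ (x - 1) * t `^ y.
    by rewrite powRD// tn0 implybT.
  rewrite (_ : x + 2^-1 - 1 = x - 1 + 2^-1); last by ring.
  rewrite (_ : x + 1 - 1 = x - 1 + 1); last by ring.
  rewrite !t_shift powR12_sqrt ?(ltW t0)// powRr1 ?(ltW t0)//.
  have := mulr_ge0 (powR_ge0 t (x - 1)) (expR_ge0 (- t)).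
  move: (t `^ (x - 1)) (expR (- t)) => P E PE0.
  have : t = Num.sqrt t ^+ 2 by rewrite sqr_sqrtr// ltW.
  move: (Num.sqrt t) => u ->; rewrite xE.
  by have := mulr_ge0 PE0 (sqr_ge0 (s - u)); lra.
rewrite -(ler_pM2l s0); move: main; rewrite GammaS//.
by move: (Gamma _) (Gamma x) => G' G; rewrite xE; lra.
Qed.

(** * The differences of the logarithm *)

Lemma sigma0 {R : realType} (p : R) : sigma p 0 = ln p.
Proof. by rewrite /sigma big_nat1 expr0 bin0 !mul1r addr0. Qed.

(** Pascal's rule. *)
Lemma sigmaS {R : realType} (p : R) m :
  sigma p m.+1 = sigma p m - sigma (p + 1) m.
Proof.
rewrite /sigma big_nat_recl// -sumrN.
rewrite [X in _ = X + _](_ : _ = (-1) ^+ 0 * 'C(m, 0)%:R * ln (p + 0%:R) +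
    \sum_(0 <= j < m.+1) (-1) ^+ j.+1 * 'C(m, j.+1)%:R * ln (p + j.+1%:R)).
  rewrite -addrA -big_split/= !bin0; congr (_ + _); apply: eq_big_nat => j _.
  have -> : p + 1 + j%:R = p + j.+1%:R by rewrite -natr1; ring.
  by rewrite binS natrD exprS; ring.
rewrite [in RHS]big_nat_recr//= (bin_small (ltnSn m)) mulr0 mul0r.
by rewrite big_nat_recl// !addr0.
Qed.

(** The [m]-th iterate of [f |-> f - f (_ + 1)] applied to [x |-> x^-1], in
    closed form; hence the derivative of [sigma ^~ m]. *)
Definition dsigma {R : realType} (p : R) (m : nat) : R :=
  m`!%:R / \prod_(0 <= j < m.+1) (p + j%:R).

Lemma prod_shift_gt0 {R : realType} (p : R) n : 0 < p ->
  0 < \prod_(0 <= j < n) (p + j%:R).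
Proof. by move=> p0; apply: prodr_gt0 => j _; rewrite ltr_wpDr. Qed.

Lemma dsigmaS {R : realType} (p : R) m : 0 < p ->
  dsigma p m.+1 = dsigma p m - dsigma (p + 1) m.
Proof.
move=> p0; rewrite /dsigma.
set P := \prod_(0 <= j < m) (p + 1 + j%:R).
have P0 : 0 < P by apply: prod_shift_gt0; lra.
have shiftE n : \prod_(0 <= j < n.+1) (p + j%:R) =
    p * \prod_(0 <= j < n) (p + 1 + j%:R).
  rewrite big_nat_recl// addr0; congr (_ * _); apply: eq_big_nat => j _.
  by rewrite -natr1 addrAC addrA.
rewrite !shiftE big_nat_recr//= -/P factS natrM -natr1.
have : 0 <= m%:R :> R by [].
move: (m%:R) => x x0; field.
by rewrite !gt_eqF//; lra.
Qed.

Lemma is_derive_sigma {R : realType} (p : R) m : 0 < p ->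
  is_derive p 1 (sigma ^~ m : R -> R) (dsigma p m).
Proof.
elim: m p => [|m IH] p p0.
  rewrite (_ : sigma ^~ 0%N = @ln R); last by apply/funext => x; rewrite sigma0.
  rewrite /dsigma big_nat1 addr0 fact0 mul1r; exact: is_derive1_ln.
rewrite (_ : sigma ^~ m.+1 =
    (sigma ^~ m : R -> R) \- (sigma ^~ m \o (+%R^~ 1))); last first.
  by apply/funext => x; rewrite sigmaS.
rewrite dsigmaS//; apply: is_deriveB; first exact: IH.
rewrite -[dsigma (p + 1) m]mulr1.
apply: is_derive1_comp; first by apply: IH; lra.
exact: is_derive_shift.
Qed.

(** The increment of [sigma ^~ m] over [[p, p + 1]] is [- sigma p m.+1]. *)
Lemma sigmaS_mean {R : realType} (p : R) m : 0 < p ->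
  exists2 x, p < x & - sigma p m.+1 = dsigma x m.
Proof.
move=> p0.
have derS x : p <= x -> is_derive x 1 (sigma ^~ m) (dsigma x m).
  by move=> px; apply: is_derive_sigma; apply: lt_le_trans px.
have [| | |c] := @MVT R (sigma ^~ m) (dsigma ^~ m) p (p + 1).
- lra.
- by move=> x; rewrite in_itv/= => /andP[/ltW px _]; exact: derS.
- apply: derivable_within_continuous => x; rewrite in_itv/= => /andP[px _].
  exact: (@ex_derive _ _ _ _ _ _ _ (derS _ px)).
rewrite in_itv/= => /andP[pc _] E; exists c => //.
by rewrite sigmaS; move: E; rewrite addrAC subrr add0r mulr1; lra.
Qed.

Lemma dsigma_gt0 {R : realType} (p : R) m : 0 < p -> 0 < dsigma p m.
Proof. by move=> p0; rewrite divr_gt0 ?prod_shift_gt0// ltr0n fact_gt0. Qed.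

Lemma dsigma_le {R : realType} (p x : R) m : 0 < p -> p <= x ->
  dsigma x m <= m`!%:R / p ^+ m.+1.
Proof.
move=> p0 px; rewrite ler_wpM2l// lef_pV2 ?posrE ?exprn_gt0 ?prod_shift_gt0//;
  last lra.
rewrite -[m.+1 in leLHS]subn0 -prodr_const_nat; apply: ler_prod => j _.
by rewrite (ltW p0)/= (le_trans px)// lerDl.
Qed.

Lemma sigmaS_lt0 {R : realType} (p : R) m : 0 < p -> sigma p m.+1 < 0.
Proof.
move=> p0; have [x px E] := sigmaS_mean p m p0.
by rewrite -oppr_gt0 E dsigma_gt0//; lra.
Qed.

Lemma sigma1 {R : realType} (p : R) : 0 < p -> - sigma p 1 = ln ((p + 1) / p).
Proof.
by move=> p0; rewrite sigmaS !sigma0 ln_div ?posrE//; lra.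
Qed.

Lemma sigmaS_ge_sigma1 {R : realType} (p : R) m : 0 < p ->
  - sigma p m.+1 <= - sigma p 1.
Proof.
move=> p0; elim: m => // m IH; rewrite sigmaS.
by have := sigmaS_lt0 (p + 1) m; lra.
Qed.

Lemma sigma1_bound {R : realType} (p : R) : 0 < p -> - sigma p 1 <= p^-1.
Proof.
move=> p0; rewrite sigma1// mulrDl divff ?gt_eqF// mul1r.
apply: le_ln1Dx; have : 0 < p^-1 by rewrite invr_gt0. lra.
Qed.

(** * The functional equations of [lnU] and [ln r] *)

Lemma lnUS {R : realType} k (p : R) :
  lnU k.+1 p = lnU k p + 2 ^- k.+2 * sigma p k.+1.
Proof. by rewrite /lnU big_nat_recr. Qed.

(** Since [sigma (p + 1) m = sigma p m - sigma p m.+1], the [m]-th term on the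
    left is [2 ^- m * sigma p m - 2 ^- m.+1 * sigma p m.+1]; the sum
    telescopes. *)
Lemma lnU_shift {R : realType} k (p : R) :
  lnU k p + lnU k (p + 1) = 2^-1 * sigma p 1 - 2 ^- k.+1 * sigma p k.+1.
Proof.
elim: k => [|k IH]; first by rewrite /lnU !big_geq// addr0 expr1 subrr.
have -> : lnU k.+1 p + lnU k.+1 (p + 1) = lnU k p + lnU k (p + 1) +
   2 ^- k.+2 * (sigma p k.+1 + sigma (p + 1) k.+1) by rewrite !lnUS; ring.
rewrite IH (sigmaS p k.+1) [2 ^+ k.+2]exprS invfM; lra.
Qed.

Lemma lnU_le0 {R : realType} k (p : R) : 0 < p -> lnU k p <= 0.
Proof.
move=> p0; elim: k => [|k IH]; first by rewrite /lnU big_geq.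
rewrite lnUS -[leRHS]addr0 lerD// mulr_ge0_le0 ?invr_ge0 ?exprn_ge0//.
by rewrite ltW ?sigmaS_lt0.
Qed.

Lemma ln_sqrt {R : realType} (y : R) : 0 < y -> ln (Num.sqrt y) = 2^-1 * ln y.
Proof. by move=> y0; rewrite -powR12_sqrt ?ltW// ln_powR. Qed.

Lemma r_gt0 {R : realType} (p : R) : 0 < p -> 0 < r p.
Proof.
move=> p0; rewrite /r mulr_gt0 ?sqrtr_gt0 ?divr_gt0// Gamma_gt0//.
all: by rewrite ?divr_gt0 ?addr_gt0.
Qed.

(** The two Gamma factors at [(p + 1) / 2] cancel, and those at [p / 2] and
    [p / 2 + 1] have ratio [p / 2]. *)
Lemma r_shift {R : realType} (p : R) : 0 < p ->
  r p * r (p + 1) = Num.sqrt (p / (p + 1)).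
Proof.
move=> p0.
have p10 : 0 < p + 1 by rewrite addr_gt0.
rewrite /r (_ : (p + 1 + 1) / 2 = p / 2 + 1); last by field.
rewrite GammaS ?divr_gt0//.
have G0 : Gamma (p / 2) != 0 by rewrite gt_eqF// Gamma_gt0// divr_gt0.
have G1 : Gamma ((p + 1) / 2) != 0 by rewrite gt_eqF// Gamma_gt0// divr_gt0.
transitivity (Num.sqrt (2 / p) * Num.sqrt (2 / (p + 1)) * (p / 2)).
  move: G0 G1; move: (Gamma _) (Gamma _) (Num.sqrt _) (Num.sqrt _).
  by move=> G0 G1 s0 s1 G0_neq0 G1_neq0; field; rewrite G0_neq0 G1_neq0.
have -> : p / 2 = Num.sqrt ((p / 2) ^+ 2).
  by rewrite sqrtr_sqr ger0_norm// divr_ge0// ltW.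
rewrite -!sqrtrM ?mulr_ge0 ?divr_ge0 ?invr_ge0 ?(ltW p0) ?(ltW p10)//.
by congr Num.sqrt; field; rewrite !gt_eqF.
Qed.

Lemma r_le1 {R : realType} (p : R) : 0 < p -> r p <= 1.
Proof.
move=> p0; have p20 : 0 < p / 2 by rewrite divr_gt0.
have -> : 1 = Num.sqrt (2 / p) * Num.sqrt (p / 2) :> R.
  rewrite -sqrtrM ?divr_ge0 ?(ltW p0)// (_ : 2 / p * (p / 2) = 1) ?sqrtr1//.
  by field; rewrite gt_eqF.
rewrite ler_wpM2l ?sqrtr_ge0// ler_pdivrMr ?Gamma_gt0// mulrDl mul1r.
exact: Gamma_half_le.
Qed.

Lemma ln_r_shift {R : realType} (p : R) : 0 < p ->
  ln (r p) + ln (r (p + 1)) = 2^-1 * sigma p 1.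
Proof.
move=> p0; have p10 : 0 < p + 1 by rewrite addr_gt0.
rewrite -lnM ?posrE ?r_gt0// r_shift// ln_sqrt ?divr_gt0//.
by rewrite ln_div ?posrE// sigmaS !sigma0.
Qed.

(** * Remainders of alternating series *)

(** As [d p - d (p + 2) = s p - s (p + 1) > 0], the values [d (p + 2 n)]
    strictly decrease to the limit [0]. *)
Lemma alternating_remainder_gt0 {R : realType} (d s : R -> R) :
  (forall p, 0 < p -> d p + d (p + 1) = s p) ->
  (forall p, 0 < p -> s (p + 1) < s p) ->
  (forall p, 0 < p -> d (p + n%:R) @[n --> \oo] --> (0 : R)) ->
  forall p, 0 < p -> 0 < d p.
Proof.
move=> ds s_decr d0.
have d_step p : 0 < p -> d (p + 2) < d p.
  move=> p0; have p1 : 0 < p + 1 by lra.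
  have := ds _ p0; have := ds _ p1; have := s_decr _ p0.
  by rewrite -addrA (_ : 1 + 1 = 2 :> R); lra.
have d_ge0 p : 0 < p -> 0 <= d p.
  move=> p0; rewrite leNgt; apply/negP => dp_lt0.
  have dn n : d (p + (n * 2)%:R) <= d p.
    elim: n => [|n IH]; first by rewrite addr0.
    apply: le_trans IH; rewrite mulSn addnC natrD addrA; apply/ltW/d_step.
    by rewrite ltr_wpDr.
  have [N _ dN] := cvgr_gt 0 (d0 _ p0) _ dp_lt0.
  have := dn N; rewrite leNgt => /negP; apply.
  by apply: dN => /=; rewrite leq_pmulr.
move=> p p0; apply: le_lt_trans (d_step _ p0).
by apply: d_ge0; lra.
Qed.

(** The two hypotheses trap [f p] between [sigma p 1 / 2 >= - p^-1 / 2] and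
    [0]. Both [lnU k] and [ln r] satisfy them. *)
Lemma shift_bounded_cvg0 {R : realType} (f : R -> R) :
  (forall p, 0 < p -> f p <= 0) ->
  (forall p, 0 < p -> 2^-1 * sigma p 1 <= f p + f (p + 1)) ->
  forall p, 0 < p -> f (p + n%:R) @[n --> \oo] --> (0 : R).
Proof.
move=> f_le0 f_shift p p0.
apply: (@squeeze_cvgr _ _ _ _ (fun n => - n.+1%:R^-1) (cst 0)).
- near=> n.
  have n1 : 1 <= n%:R :> R by rewrite ler1n; near: n; exact: nbhs_infty_gt.
  have pn0 : 0 < p + n%:R by rewrite ltr_wpDr.
  have pn10 : 0 < p + n%:R + 1 by rewrite addr_gt0.
  rewrite f_le0// andbT /=.
  have := f_shift _ pn0; have := f_le0 _ pn10; have := sigma1_bound _ pn0.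
  have : (p + n%:R)^-1 <= 2 * n.+1%:R^-1.
    rewrite -[leRHS]invf_div lef_pV2 ?posrE ?divr_gt0//.
    by rewrite -natr1; lra.
  move: (f (p + n%:R)) (f (p + n%:R + 1)) (sigma (p + n%:R) 1) => y z w.
  by move: (p + n%:R)^-1 (n.+1%:R^-1 : R) => u v; lra.
- by rewrite -(oppr0 R); apply: cvgN; exact: cvg_harmonic.
- exact: cvg_cst.
Unshelve. all: end_near. Qed.

(** * The gap between [lnU] and [ln r] *)

Definition gap {R : realType} (k : nat) (p : R) : R := lnU k p - ln (r p).

Lemma gap_cvg0 {R : realType} k (p : R) : 0 < p ->
  gap k (p + n%:R) @[n --> \oo] --> (0 : R).
Proof.
move=> p0; rewrite -(subr0 0); apply: cvgB.
  apply: shift_bounded_cvg0 => // {p0}p p0; first exact: lnU_le0.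
  rewrite lnU_shift lerBrDl ler_wnDl// mulr_ge0_le0 ?invr_ge0 ?exprn_ge0//.
  by rewrite ltW ?sigmaS_lt0.
apply: (shift_bounded_cvg0 (fun p => ln (r p))) => // {p0}p p0.
  by rewrite ln_le0// r_le1.
by rewrite ln_r_shift.
Qed.

Lemma gap_shift {R : realType} k (p : R) : 0 < p ->
  gap k p + gap k (p + 1) = 2 ^- k.+1 * - sigma p k.+1.
Proof.
move=> p0; rewrite /gap addrACA -opprD lnU_shift ln_r_shift//.
by rewrite addrAC subrr add0r mulrN.
Qed.

(** The decrease of the terms [- sigma p k.+1] is the negativity of
    [sigma p k.+2]. *)
Lemma gap_gt0 {R : realType} k (p : R) : 0 < p -> 0 < gap k p.
Proof.
apply: (alternating_remainder_gt0 _ (fun p => 2 ^- k.+1 * - sigma p k.+1)).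
- exact: gap_shift.
- move=> {}p p0; rewrite ltr_pM2l ?invr_gt0 ?exprn_gt0// ltrN2.
  by have := sigmaS_lt0 p k.+1 p0; rewrite sigmaS subr_lt0.
- exact: gap_cvg0.
Qed.

(** The difference [gap k p - gap k (p + 1)] is itself the remainder of an
    alternating series, with [sigma p k.+2] in place of [sigma p k.+1]. *)
Lemma gap_shift_lt {R : realType} k (p : R) : 0 < p -> gap k (p + 1) < gap k p.
Proof.
move=> p0; rewrite -subr_gt0; move: p p0.
apply: (alternating_remainder_gt0 (fun p => gap k p - gap k (p + 1))
  (fun p => 2 ^- k.+1 * - sigma p k.+2)).
- move=> p p0; have p10 : 0 < p + 1 by rewrite addr_gt0.
  have := gap_shift k _ p0; have := gap_shift k _ p10.
  rewrite (sigmaS p k.+1); move: (2 ^- k.+1) (sigma p _) (sigma (p + 1) _).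
  by move: (gap k p) (gap k (p + 1)) (gap k _) => x y z c s t; lra.
- move=> p p0; rewrite ltr_pM2l ?invr_gt0 ?exprn_gt0// ltrN2.
  by have := sigmaS_lt0 p k.+2 p0; rewrite sigmaS subr_lt0.
- move=> p p0; rewrite -(subr0 0); apply: cvgB; first exact: gap_cvg0.
  under eq_cvg => n do rewrite addrAC.
  by apply: gap_cvg0; rewrite addr_gt0.
Qed.

(** The other part of the sum [gap k p + gap k (p + 1)] is positive. *)
Lemma gap_lt {R : realType} k (p : R) : 0 < p ->
  gap k p < 2 ^- k.+1 * - sigma p k.+1.
Proof.
by move=> p0; rewrite -gap_shift// ltrDl gap_gt0// addr_gt0.
Qed.

Lemma gapS_lt {R : realType} k (p : R) : 0 < p -> gap k.+1 p < gap k p.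
Proof.
move=> p0; rewrite /gap lnUS ltrD2r -[ltRHS]addr0 ltrD2l.
by rewrite pmulr_rlt0 ?invr_gt0 ?exprn_gt0// sigmaS_lt0.
Qed.

Lemma U_gap {R : realType} k (p : R) : 0 < p -> U k p = r p * expR (gap k p).
Proof.
move=> p0; rewrite /gap expRD expRN lnK ?posrE ?r_gt0// mulrC mulfVK//.
by rewrite gt_eqF// r_gt0.
Qed.

Lemma L_gap {R : realType} k (p : R) : 0 < p ->
  L k p = r p * expR (- gap k (p + 1)).
Proof.
move=> p0; have p10 : 0 < p + 1 by rewrite addr_gt0.
rewrite /L U_gap// -r_shift// expRN invfM mulrA mulfK//.
by rewrite gt_eqF// r_gt0.
Qed.

(** * Bounds and limits *)

(** The two entries of the minimum bound [- sigma p k.+1] for different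
    reasons: the first as a value of [dsigma] beyond [p], the second as
    [- sigma p 1], because [- sigma p m] decreases with [m]. *)
Lemma sigma_le_rho {R : realType} k (p : R) : 0 < p ->
  2 ^- k.+1 * - sigma p k.+1 <= rho k p.
Proof.
move=> p0; rewrite ler_wpM2l ?invr_ge0 ?exprn_ge0// le_min -sigma1//.
rewrite sigmaS_ge_sigma1// andbT; have [x px ->] := sigmaS_mean p k p0.
apply: le_trans (dsigma_le p x k p0 (ltW px)) _.
rewrite ler_wpM2r ?invr_ge0 ?exprn_ge0 ?(ltW p0)//.
by rewrite ler_nat factS leq_pmull.
Qed.

Lemma rho_ge0 {R : realType} k (p : R) : 0 < p -> 0 <= rho k p.
Proof.
move=> p0; apply: le_trans (sigma_le_rho k p p0); rewrite mulr_ge0//.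
by rewrite oppr_ge0 ltW ?sigmaS_lt0.
Qed.

Lemma rho_le {R : realType} k (p : R) : 0 < p -> rho k p <= 2 ^- k.+1 * p^-1.
Proof.
move=> p0; rewrite ler_wpM2l ?invr_ge0 ?exprn_ge0// ge_min -sigma1//.
by rewrite sigma1_bound ?orbT.
Qed.

Lemma rho_geometric {R : realType} k (p0 p : R) : 0 < p0 -> p0 <= p ->
  rho k p <= p0^-1 * 2^-1 ^+ k.
Proof.
move=> p00 pp; have p_gt0 : 0 < p by exact: lt_le_trans pp.
apply: le_trans (rho_le k p p_gt0) _.
rewrite mulrC exprVn ler_pM ?invr_ge0 ?exprn_ge0 ?(ltW p_gt0)//.
  by rewrite lef_pV2 ?posrE.
by rewrite lef_pV2 ?posrE ?exprn_gt0// ler_eXn2l// ?ltr1n.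
Qed.

Lemma gap_le {R : realType} k (p0 p : R) : 0 < p0 -> p0 <= p ->
  gap k p <= p0^-1 * 2^-1 ^+ k.
Proof.
move=> p00 pp; have p_gt0 : 0 < p by exact: lt_le_trans pp.
apply: le_trans (ltW (gap_lt k p p_gt0)) _.
by apply: le_trans (sigma_le_rho k p p_gt0) _; exact: rho_geometric.
Qed.

Lemma geometric_cvg0 {R : realType} (c : R) :
  c * 2^-1 ^+ k @[k --> \oo] --> (0 : R).
Proof.
rewrite -(mulr0 c); apply: cvgMl_tmp; apply: cvg_expr.
by rewrite ger0_norm ?invf_lt1 ?ltr1n.
Qed.

Lemma lnU_ooE {R : realType} (p : R) : 0 < p -> lnU_oo p = ln (r p).
Proof.
move=> p0; apply/cvg_lim => //.
have gap0 : gap k p @[k --> \oo] --> (0 : R).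
  apply: (@squeeze_cvgr _ _ _ _ (cst 0) (fun k => p^-1 * 2^-1 ^+ k)).
  - by near=> k; rewrite (ltW (gap_gt0 k p p0))/= gap_le.
  - exact: cvg_cst.
  - exact: geometric_cvg0.
rewrite -[ln (r p)]add0r.
under eq_cvg => k do rewrite -[lnU k p](subrK (ln (r p))).
by apply: cvgD gap0 _; exact: cvg_cst.
Unshelve. all: end_near. Qed.

Lemma lnU_uniform_cvg {R : realType} (p0 : R) : 0 < p0 ->
  {uniform `[p0, +oo[%classic, (@lnU R) @ \oo --> (@lnU_oo R)}.
Proof.
move=> p00 P /uniform_nbhs[E [entE EP]].
have [e /= e0 eE] : exists2 e : R, 0 < e &
    [set xy : R * R | ball xy.1 e xy.2] `<=` E.
  by move: entE; rewrite -entourage_ballE => -[e /= e0 eE]; exists e.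
have small := cvgr_lt 0 (geometric_cvg0 p0^-1) _ e0.
suff : \forall k \near \oo, P (lnU k) by [].
near=> k; apply: EP => p /=; rewrite in_itv/= andbT => pp; apply: eE => /=.
have p_gt0 : 0 < p by exact: lt_le_trans pp.
rewrite /ball/= distrC lnU_ooE// -/(gap k p) gtr0_norm ?gap_gt0//.
apply: le_lt_trans (gap_le k p0 p p00 pp) _.
near: k; exact: small.
Unshelve. all: end_near. Qed.

Lemma U_ooE {R : realType} (p : R) : 0 < p -> U_oo p = r p.
Proof. by move=> p0; rewrite /U_oo lnU_ooE// lnK// posrE r_gt0. Qed.

Lemma L_ooE {R : realType} (p : R) : 0 < p -> L_oo p = r p.
Proof.
move=> p0; have p10 : 0 < p + 1 by rewrite addr_gt0.
by rewrite /L_oo U_ooE// -r_shift// mulfK// gt_eqF// r_gt0.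
Qed.

Lemma delta_upE {R : realType} k (p : R) : 0 < p ->
  delta_up k p = expR (gap k p) - 1.
Proof.
move=> p0; have rp0 := r_gt0 p p0.
by rewrite /delta_up U_gap//; field; rewrite gt_eqF.
Qed.

Lemma delta_loE {R : realType} k (p : R) : 0 < p ->
  delta_lo k p = 1 - expR (- gap k (p + 1)).
Proof.
move=> p0; have rp0 := r_gt0 p p0.
by rewrite /delta_lo L_gap//; field; rewrite gt_eqF.
Qed.

Lemma rho_cvg_pinfty {R : realType} (k : nat) :
  rho k p @[p --> +oo] --> (0 : R).
Proof.
apply/cvgrPdist_le => e e0; near=> p.
have p0 : 0 < p by near: p; exact: nbhs_pinfty_gt.
rewrite sub0r normrN ger0_norm ?rho_ge0//.
apply: le_trans (rho_le k p p0) _.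
apply: (@le_trans _ _ p^-1).
  rewrite ler_piMl ?invr_ge0 ?(ltW p0)// invf_le1 ?exprn_gt0//.
  by rewrite exprn_ege1// ler1n.
rewrite invf_ple ?posrE//; near: p; exact: nbhs_pinfty_ge.
Unshelve. all: end_near. Qed.

Theorem theorem1p1 (R : realType) :
  (forall p : R, 0 < p -> r p = U_oo p /\ U_oo p = L_oo p) /\
  (forall p0 : R, 0 < p0 ->
     {uniform `[p0, +oo[%classic, (@lnU R) @ \oo --> (@lnU_oo R)}) /\
  (forall p : R, 0 < p -> forall k : nat,
     [/\ L k p < L k.+1 p, L k.+1 p < r p, r p < U k.+1 p & U k.+1 p < U k p]) /\
  (forall p : R, 0 < p -> forall k : nat,
     [/\ delta_up k p = `|(U k p - r p) / r p|,
         delta_lo k p = `|(L k p - r p) / r p|,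
         0 < delta_lo k p,
         delta_lo k p < delta_up k p &
         delta_up k p < expR (rho k p) - 1]) /\
  (forall p0 : R, 0 < p0 ->
     exists C q : R, [/\ 0 < C, 0 < q, q < 1 &
       forall p : R, p0 <= p -> forall k : nat,
         0 <= rho k p /\ rho k p <= C * q ^+ k]) /\
  (forall k : nat, rho k p @[p --> +oo] --> (0 : R)).
Proof.
split; [|split; [|split; [|split; [|split]]]].
- by move=> p p0; rewrite U_ooE// L_ooE.
- exact: lnU_uniform_cvg.
- move=> p p0 k; have p10 : 0 < p + 1 by rewrite addr_gt0.
  rewrite !L_gap// !U_gap//; split.
  + by rewrite ltr_pM2l ?r_gt0// ltr_expR ltrN2 gapS_lt.
  + by rewrite gtr_pMr ?r_gt0// expR_lt1 oppr_lt0 gap_gt0.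
  + by rewrite ltr_pMr ?r_gt0// expR_gt1 gap_gt0.
  + by rewrite ltr_pM2l ?r_gt0// ltr_expR gapS_lt.
- move=> p p0 k; have p10 : 0 < p + 1 by rewrite addr_gt0.
  have up_gt0 : 0 < delta_up k p.
    by rewrite delta_upE// subr_gt0 expR_gt1 gap_gt0.
  have lo_gt0 : 0 < delta_lo k p.
    by rewrite delta_loE// subr_gt0 expR_lt1 oppr_lt0 gap_gt0.
  split => //.
  + by rewrite -/(delta_up k p) gtr0_norm.
  + by rewrite -opprB mulNr normrN -/(delta_lo k p) gtr0_norm.
  + rewrite delta_loE// delta_upE//.
    (* [1 - expR (- b) <= b < a <= expR a - 1] for the gaps [b], [a] at
       [p + 1], [p] *)
    have := expR_ge1Dx (- gap k (p + 1)); have := expR_ge1Dx (gap k p).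
    move: (gap_shift_lt k p p0) {up_gt0 lo_gt0}.
    by move: (gap k p) (gap k (p + 1)) => a b ab; lra.
  + rewrite delta_upE// ltrD2r ltr_expR.
    exact: lt_le_trans (gap_lt k p p0) (sigma_le_rho k p p0).
- move=> p0 p00; exists p0^-1, 2^-1; split; rewrite ?invr_gt0//.
    by rewrite invf_lt1 ?ltr1n.
  move=> p pp k; have p_gt0 : 0 < p by exact: lt_le_trans pp.
  by rewrite rho_ge0//; split=> //; exact: rho_geometric.
- exact: rho_cvg_pinfty.
Qed.
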